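(* Let $B$ be a Bratteli diagram with incidence matrices $\{F_n\}_{n=0}^\infty$, and let $\mu$ be a probability $\mathcal E$-invariant measure on $X_B$. Let $\overline B \subset B$ be an edge subdiagram, and let $Y^{(1)}_{\overline B}$ be the set of all paths $x=(x_1,x_2,\dots)\in X_B$ whose first edge $x_1$ lies in $\overline B$. Then the series $$\widetilde{S} = \sum_{n=1}^{\infty} \sum_{v \in V_{n+1}} \sum_{w \in V_{n}} \widetilde f_{v,w}^{(n)} p_v^{(n+1)}\overline h_{w}^{(n)},\qquad \widetilde f_{v,w}^{(n)}=f_{v,w}^{(n)}-\overline f_{v,w}^{(n)},$$ is always convergent and $\mu(X_{\overline B}) = \mu(Y^{(1)}_{\overline B}) - \widetilde{S}$. Hence, $$\mu(X_{\overline{B}}) = 0 \quad \Longleftrightarrow \quad \widetilde{S} = \mu(Y^{(1)}_{\overline B}).$$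
   Context: A Bratteli diagram $B=(V,E)$ is an infinite graph with $V=\bigcup_{i\ge 0}V_i$, $E=\bigcup_{i\ge1}E_i$ (disjoint finite levels, $V_0=\{v_0\}$), with range and source maps $r,s$ on edges such that $r(E_i)=V_i$, $s(E_i)=V_{i-1}$, $s^{-1}(v)\ne\emptyset$ for all $v$, and $r^{-1}(v)\neq\emptyset$ for all $v\ne v_0$. The $n$-th incidence matrix is $F_n=(f^{(n)}_{v,w})_{v\in V_{n+1},w\in V_n}$, where $f^{(n)}_{v,w}$ is the number of edges from $w$ to $v$. $X_B$ is the space of infinite paths starting at $v_0$ with the cylinder topology, assumed to be a Cantor set. Two paths are tail equivalent, $(x,y)\in\mathcal E$, if they agree from some index on. A measure is $\mathcal E$-invariant if any two cylinder sets given by finite paths from $v_0$ to the same vertex have equal measure; $p^{(n)}_v$ is the $\mu$-measure of the cylinder set of any finite path from $v_0$ to $v\in V_n$. An edge subdiagram $\overline B$ of $B$ has the same vertices $V_n$ and incidence matrices $\overline F_n=(\overline f^{(n)}_{v,w})$ obtained by removing edges, so $\overline F_n\le F_n$ entrywise, with the requirement that $f^{(n)}_{v,w}>0$ implies $\overline f^{(n)}_{v,w}>0$. $X_{\overline B}\subset X_B$ is its set of infinite paths, and $\overline h^{(n)}_w$ is the number of finite paths in $\overline B$ from $v_0$ to $w\in V_n$. *)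

(* Defs.v *)
From HB Require Import structures.
From mathcomp Require Import all_boot all_order all_algebra.
From mathcomp Require Import finmap.
From mathcomp Require Import all_classical all_reals all_analysis.

Set Implicit Arguments.
Unset Strict Implicit.
Unset Printing Implicit Defensive.

Import Order.TTheory GRing.Theory Num.Theory.

Local Open Scope classical_set_scope.
Local Open Scope ring_scope.

(* Levels are separate finite types, hence disjoint.  [edge n] is the set
   $E_{n+1}$ of edges from $V_n$ to $V_{n+1}$, so that its incidence matrix
   is $F_n$. *)
Record bratteli := Bratteli {
  vertex : nat -> finType;
  edge : nat -> finType;
  src : forall n, edge n -> vertex n;
  rng : forall n, edge n -> vertex n.+1;
  v0 : vertex 0;
  vertex0_unique : forall v : vertex 0, v = v0;
  src_surj : forall n (v : vertex n), exists e : edge n, src e == v;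
  rng_surj : forall n (v : vertex n.+1), exists e : edge n, rng e == v
}.

Arguments src {b n} e.
Arguments rng {b n} e.
Arguments v0 {b}.
Arguments src_surj {b n} v.
Arguments rng_surj {b n} v.

(* The edge $x_{n+1}$ of an infinite path is [x n].  The path starts at [v0]
   because [vertex B 0] has no other element. *)
Record path_space (B : bratteli) := Path {
  path_edge :> forall n, edge B n;
  path_edgeP : forall n, rng (path_edge n) = src (path_edge n.+1)
}.

(* Finite paths from [v0] to [v : vertex B n]: a last edge [e] with range [v],
   preceded by a finite path from [v0] to the source of [e]. *)
Fixpoint fpath (B : bratteli) (n : nat) : vertex B n -> finType :=
  match n with
  | 0 => fun=> unit
  | m.+1 => fun v => {e : {e : edge B m | rng e == v} & fpath (src (val e))}
  end.

Fixpoint cylinder (B : bratteli) (n : nat) :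
    forall v : vertex B n, fpath v -> set (path_space B) :=
  match n with
  | 0 => fun _ _ => setT
  | m.+1 => fun v p =>
      [set x : path_space B | x m = val (tag p)] `&` cylinder (tagged p)
  end.

Section PathSpaceInstances.
Variable B : bratteli.

HB.instance Definition _ := gen_eqMixin (path_space B).
HB.instance Definition _ := gen_choiceMixin (path_space B).

Fixpoint point_edge (n : nat) : edge B n :=
  match n with
  | 0 => xchoose (src_surj v0)
  | m.+1 => xchoose (src_surj (rng (point_edge m)))
  end.

Lemma point_edgeP n : rng (point_edge n) = src (point_edge n.+1).
Proof. by rewrite [RHS](eqP (xchooseP (src_surj (rng (point_edge n))))). Qed.

HB.instance Definition _ := isPointed.Build (path_space B) (Path point_edgeP).

Definition cylinders : set (set (path_space B)) :=
  [set C | exists n (v : vertex B n) (p : fpath v), C = cylinder p].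

HB.instance Definition _ :=
  @isSubBaseTopological.Build (path_space B) (set (path_space B)) cylinders id.

End PathSpaceInstances.

Notation borel_path_space B :=
  (g_sigma_algebraType (@open (path_space B))).

Definition is_cantor_set (T : topologicalType) : Prop :=
  exists (f : T -> cantor_space) (g : cantor_space -> T),
    [/\ cancel f g, cancel g f, continuous f & continuous g].

Definition incidence (B : bratteli) n (v : vertex B n.+1) (w : vertex B n) :
  nat := #|[set e : edge B n | (src e == w) && (rng e == v)]%SET|.

(* Incidence numbers of the graph that keeps only the edges in [A]. *)
Definition incidence_in (B : bratteli) (A : forall n, {set edge B n})
    n (v : vertex B n.+1) (w : vertex B n) : nat :=
  #|[set e : edge B n | [&& e \in A n, src e == w & rng e == v]]%SET|.

Record edge_subdiagram (B : bratteli) := EdgeSubdiagram {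
  sub_edge : forall n, {set edge B n};
  sub_edge_gt0 : forall n (v : vertex B n.+1) (w : vertex B n),
    (0 < incidence v w)%N -> (0 < incidence_in sub_edge v w)%N
}.

Section Subdiagram.
Variables (B : bratteli) (B' : edge_subdiagram B).

Definition sub_incidence n (v : vertex B n.+1) (w : vertex B n) : nat :=
  incidence_in (sub_edge B') v w.

Fixpoint fpath_in (n : nat) : forall v : vertex B n, fpath v -> bool :=
  match n with
  | 0 => fun _ _ => true
  | m.+1 => fun v p =>
      (val (tag p) \in sub_edge B' m) && fpath_in (tagged p)
  end.

Definition sub_height n (w : vertex B n) : nat :=
  #|[set p : fpath w | fpath_in p]%SET|.

Definition sub_path_space : set (path_space B) :=
  [set x : path_space B | forall n, x n \in sub_edge B' n].

Definition first_edge_in : set (path_space B) :=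
  [set x : path_space B | x 0 \in sub_edge B' 0].

End Subdiagram.

Section Measure.
Variables (B : bratteli) (R : realType).
Implicit Types mu : set (path_space B) -> \bar R.

Definition tail_invariant mu : Prop :=
  forall n (v : vertex B n) (p q : fpath v), mu (cylinder p) = mu (cylinder q).

(* $p^{(n)}_v$: by invariance the choice of the path does not matter, see
   [vertex_measureE]; the default value is never used, see [fpath_gt0]. *)
Definition vertex_measure mu n (v : vertex B n) : R :=
  if [pick p : fpath v] is Some p then fine (mu (cylinder p)) else 0.

Lemma fpath_gt0 n (v : vertex B n) : (0 < #|fpath v|)%N.
Proof.
elim: n v => [|n IH] v; first by rewrite /= card_unit.
have [e rev] := rng_surj v; have /card_gt0P[p _] := IH (src e).
by apply/card_gt0P; exists (existT _ (exist _ e rev) p).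
Qed.

Lemma open_cylinder n (v : vertex B n) (p : fpath v) : open (cylinder p).
Proof.
exists [set cylinder p]; last by rewrite bigcup_set1.
move=> _ ->; exists [fset cylinder p]%fset.
  by move=> C /fset1P ->; apply/mem_set; exists n, v, p.
by rewrite set_fset1 bigcap_set1.
Qed.

Lemma measurable_cylinder n (v : vertex B n) (p : fpath v) :
  measurable (cylinder p : set (borel_path_space B)).
Proof. by apply: sub_sigma_algebra; exact: open_cylinder. Qed.

Lemma vertex_measureE (mu : probability (borel_path_space B) R)
    n (v : vertex B n) (p : fpath v) :
  tail_invariant mu -> mu (cylinder p) = (vertex_measure mu v)%:E.
Proof.
move=> inv; rewrite /vertex_measure; case: pickP => [q _|/(_ p) //].
rewrite (inv _ _ p q) fineK// fin_num_measure//.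
exact: measurable_cylinder.
Qed.

(* The $n$-th term of $\widetilde S$. *)
Definition removed_mass mu (B' : edge_subdiagram B) (n : nat) : R :=
  \sum_(v : vertex B n.+1) \sum_(w : vertex B n)
    ((incidence v w)%:R - (sub_incidence B' v w)%:R)
    * vertex_measure mu v * (sub_height B' w)%:R.

End Measure.

(* Main.v *)
Require Import Defs.
From mathcomp Require Import all_boot all_order all_algebra.
From mathcomp Require Import all_classical all_reals all_analysis.
(* Imported again so that [fpath] denotes the finite paths of a diagram rather
   than the paths of a function in [path]. *)
Require Import Defs.

Import numFieldNormedType.Exports.

Local Open Scope classical_set_scope.
Local Open Scope ring_scope.

(** Let $Y_n$ ([sub_prefix]) be the set of infinite paths whose first $n$ edges
lie in the subdiagram.  The $Y_n$ decrease to $X_{\overline B}$, so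
$\mu(Y_n) \to \mu(X_{\overline B})$ by continuity from above
([cvg_sub_prefix]).  The theorem follows because the $n$-th term of the series
is exactly the mass lost between two consecutive sets,
$\mu(Y_n) - \mu(Y_{n+1})$ ([removed_massE]): the partial sums telescope to
$\mu(Y_1) - \mu(Y_{N+1})$, and $Y_1$ is $Y^{(1)}_{\overline B}$.

To compute $\mu(Y_n)$, observe that $Y_n$ is the disjoint union of the cylinders
of the finite paths of length $n$ in the subdiagram.  By invariance
$\mu(Y_n) = \sum_{v \in V_n} \overline h^{(n)}_v p^{(n)}_v$
([measure_sub_prefix]), and cutting off the last edge gives
$\overline h^{(n+1)}_v = \sum_w \overline f^{(n)}_{v,w} \overline h^{(n)}_w$
([sub_heightE]), which expresses $\mu(Y_{n+1})$ through level $n$.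

To compare it with $\mu(Y_n)$, the latter is also needed as a sum over the
vertices of level $n+1$.  This comes from the same two formulas, applied to the
subdiagram that agrees with $\overline B$ before level $n$ and keeps every edge
from there on ([truncation]): its $Y_{n+1}$ is the $Y_n$ of $\overline B$,
whence
$\mu(Y_n) = \sum_{v,w} f^{(n)}_{v,w} p^{(n+1)}_v \overline h^{(n)}_w$. *)

Set Implicit Arguments.
Unset Strict Implicit.
Unset Printing Implicit Defensive.
Import Order.TTheory GRing.Theory Num.Theory.

(** An infinite path has only one initial segment of each length, so distinct
finite paths of the same length have disjoint cylinders.  The end vertices
[v] and [w] are not assumed equal, hence the equality of dependent pairs. *)
Lemma cylinder_uniq (B : bratteli) n (v w : vertex B n)
    (p : fpath v) (q : fpath w) (x : path_space B) :
  cylinder p x -> cylinder q x ->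
  Tagged (fun u : vertex B n => fpath u) p = Tagged (fun u => fpath u) q.
Proof.
elim: n v w p q => [|n IHn] v w.
  by rewrite (vertex0_unique v) (vertex0_unique w) => -[] [].
move=> [[e re] p] [[e' re'] q] /= [xe xp] [xe' xq].
have /eqP ev := re; have /eqP ew := re'; subst v w.
subst e e'; rewrite (bool_irrelevance re re').
by rewrite (eq_from_Tagged (IHn _ _ _ _ xp xq)).
Qed.

Lemma cylinder_cover (B : bratteli) (x : path_space B) n :
  exists p : fpath (src (x n)), cylinder p x.
Proof.
elim: n => [|n [p xp]]; first by exists tt.
by exists (existT _ (exist _ (x n) (introT eqP (path_edgeP x n))) p).
Qed.

Definition sub_prefix (B : bratteli) (B' : edge_subdiagram B) n :
    set (path_space B) :=
  [set x : path_space B | forall i, (i < n)%N -> x i \in sub_edge B' i].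

Lemma cylinder_sub_prefix (B : bratteli) (B' : edge_subdiagram B) n
    (v : vertex B n) (p : fpath v) (x : path_space B) :
  cylinder p x -> sub_prefix B' n x <-> fpath_in B' p.
Proof.
elim: n v p => [|n IHn] v p /=; first by split=> // _ i.
case=> xe /(IHn _) {}IHn; split.
  move=> xS; apply/andP; split; first by rewrite -xe; exact: xS.
  by apply/IHn => i ltin; apply: xS; exact: ltnW.
case/andP => eS /IHn xS i.
rewrite ltnS leq_eqVlt => /predU1P[->|]; last exact: xS.
by rewrite xe.
Qed.

Lemma sub_prefixE (B : bratteli) (B' : edge_subdiagram B) n :
  sub_prefix B' n =
    \bigcup_(t in [set t : {v : vertex B n & fpath v} | fpath_in B' (tagged t)])
      cylinder (tagged t).
Proof.
apply/seteqP; split => [x xS|x [t tS xt]].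
  have [p xp] := cylinder_cover x n.
  by exists (Tagged (fun v : vertex B n => fpath v) p) => //=; apply/(cylinder_sub_prefix B' xp).
exact/(cylinder_sub_prefix B' xt).
Qed.

Lemma measurable_sub_prefix (B : bratteli) (B' : edge_subdiagram B) n :
  measurable (sub_prefix B' n : set (borel_path_space B)).
Proof.
rewrite sub_prefixE; apply: fin_bigcup_measurable; first exact: finite_finset.
by move=> t _; exact: measurable_cylinder.
Qed.

(** A finite path ending at [v] is its last edge together with a path to the
source of that edge; the edges are grouped by their source. *)
Lemma sub_heightE (B : bratteli) (B' : edge_subdiagram B) n
    (v : vertex B n.+1) :
  sub_height B' v =
  (\sum_(w : vertex B n) sub_incidence B' v w * sub_height B' w)%N.
Proof.
rewrite /sub_height cardsE -sum1_card /=.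
rewrite -(sig_big_dep (fun e : {e : edge B n | rng e == v} => val e \in sub_edge B' n)
   (fun e p => fpath_in B' p) (fun _ _ => 1%N)) /=.
rewrite -(big_sub_cond (fun e : edge B n => rng e == v) (fun e => e \in sub_edge B' n)
  (fun e => \sum_(p : fpath (src e) | fpath_in B' p) 1)%N).
rewrite (partition_big (fun e : edge B n => src e) xpredT) //=.
apply: eq_bigr => w _.
rewrite /sub_incidence /incidence_in !cardsE -!sum1_card big_distrl /=.
apply: eq_big => [e|e /andP[_ /eqP <-]].
  by rewrite !unfold_in /= andbA [RHS]andbAC (andbC (rng e == v)).
by rewrite mul1n.
Qed.

(** Keeping every edge from level [n] on turns statements about the first [n]
edges into statements about the first [n.+1] edges of another subdiagram. *)
Section Truncation.
Variables (B : bratteli) (B' : edge_subdiagram B) (n : nat).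

Definition trunc_edge i : {set edge B i} :=
  if (i < n)%N then sub_edge B' i else [set: edge B i]%SET.

Lemma trunc_edge_gt0 i (v : vertex B i.+1) (w : vertex B i) :
  (0 < incidence v w)%N -> (0 < incidence_in trunc_edge v w)%N.
Proof.
rewrite /incidence_in /trunc_edge; case: ifP => _ vw.
  exact: sub_edge_gt0.
by under eq_finset do rewrite finset.in_setT.
Qed.

Definition truncation : edge_subdiagram B := EdgeSubdiagram trunc_edge_gt0.

Lemma sub_prefix_truncation m : (n <= m)%N ->
  sub_prefix truncation m = sub_prefix B' n.
Proof.
move=> lenm; apply/seteqP; split => x xS i ltin.
  by have := xS i (leq_trans ltin lenm); rewrite /= /trunc_edge ltin.
by rewrite /= /trunc_edge; case: ifP => [/xS//|_]; rewrite finset.in_setT.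
Qed.

Lemma fpath_in_truncation m (v : vertex B m) (p : fpath v) : (m <= n)%N ->
  fpath_in truncation p = fpath_in B' p.
Proof.
elim: m v p => // m IHm v p ltmn /=.
by rewrite IHm 1?ltnW// /trunc_edge ltmn.
Qed.

Lemma sub_height_truncation (v : vertex B n) :
  sub_height truncation v = sub_height B' v.
Proof. by apply: eq_card => p; rewrite !inE fpath_in_truncation. Qed.

Lemma sub_incidence_truncation (v : vertex B n.+1) (w : vertex B n) :
  sub_incidence truncation v w = incidence v w.
Proof.
rewrite /sub_incidence /incidence_in /= /trunc_edge ltnn.
by apply: eq_card => e; rewrite !inE.
Qed.

End Truncation.

Lemma sub_path_spaceE (B : bratteli) (B' : edge_subdiagram B) :
  sub_path_space B' = \bigcap_n sub_prefix B' n.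
Proof.
apply/seteqP; split => [x xS n _ i _|x xS i]; first exact: xS.
exact: (xS i.+1).
Qed.

Section Mass.
Variables (R : realType) (B : bratteli).
Variables (mu : probability (borel_path_space B) R) (mu_inv : tail_invariant mu).

(** The cylinders that make up [sub_prefix B' n] are disjoint, and by invariance
those ending at [v] all have the mass [vertex_measure mu v]. *)
Lemma measure_sub_prefix (B' : edge_subdiagram B) n :
  mu (sub_prefix B' n) =
  (\sum_(v : vertex B n) (sub_height B' v)%:R * vertex_measure mu v)%:E.
Proof.
rewrite sub_prefixE measure_fin_bigcup; last first.
- by move=> t _; exact: measurable_cylinder.
- move=> s t _ _ [x [xs xt]]; have := cylinder_uniq xs xt.
  by case: (s) (t) => [v p] [w q].
- exact: finite_finset.
(* The sum over a finite set of dependent pairs becomes an iterated sum, over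
   the vertices and then over the paths ending there. *)
rewrite -(@bigfs _ _ _ _ (index_enum {v : vertex B n & fpath v})
            (fun t => fpath_in B' (tagged t))); last 2 first.
- exact: index_enum_uniq.
- by move=> t _; rewrite mem_index_enum.
rewrite -(sig_big_dep xpredT (fun v (p : fpath v) => fpath_in B' p)
            (fun v p => mu (cylinder p))) /= -sumEFin.
apply: eq_bigr => v _; under eq_bigr do rewrite (vertex_measureE _ mu_inv).
by rewrite sumEFin sumr_const mulr_natl /sub_height cardsE.
Qed.

(** Writing [sub_prefix B' n] as a prefix set of length [n.+1] of the truncation
puts both masses in the form of a sum over the vertices of level [n.+1], where
they differ by the full against the reduced incidence numbers. *)
Lemma removed_massE (B' : edge_subdiagram B) n :
  removed_mass mu B' n =
  fine (mu (sub_prefix B' n)) - fine (mu (sub_prefix B' n.+1)).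
Proof.
rewrite -(sub_prefix_truncation B' (leqnSn n)) !measure_sub_prefix /= -sumrB.
apply: eq_bigr => v _; rewrite !sub_heightE -mulrBl !natr_sum -sumrB mulr_suml.
apply: eq_bigr => w _.
by rewrite sub_height_truncation sub_incidence_truncation !natrM -mulrBl mulrAC.
Qed.

(** Continuity from above along the decreasing sequence of prefix sets. *)
Lemma cvg_sub_prefix (B' : edge_subdiagram B) :
  mu (sub_prefix B' n) @[n --> \oo] --> mu (sub_path_space B').
Proof.
rewrite sub_path_spaceE; apply: nonincreasing_cvg_mu.
- by rewrite ltey_eq fin_num_measure//; exact: measurable_sub_prefix.
- by move=> n; exact: measurable_sub_prefix.
- by apply: bigcapT_measurable => n; exact: measurable_sub_prefix.
- by move=> m n lemn; apply/subsetPset => x xS i ltim; exact/xS/(leq_trans ltim).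
Qed.

Lemma first_edge_inE (B' : edge_subdiagram B) : first_edge_in B' = sub_prefix B' 1.
Proof. by apply/seteqP; split => [x xS [|//] _|x xS]; last exact: xS. Qed.

End Mass.

Theorem theorem4p2 (R : realType) (B : bratteli)
  (cantorB : is_cantor_set (path_space B))
  (mu : probability (borel_path_space B) R) (mu_inv : tail_invariant mu)
  (B' : edge_subdiagram B) :
  let partial_sum (N : nat) : R :=
    \sum_(1 <= n < N.+1) removed_mass mu B' n in
  let S : R := limn partial_sum in
  [/\ cvgn partial_sum,
      mu (sub_path_space B') = (mu (first_edge_in B') - S%:E)%E &
      mu (sub_path_space B') = 0%E <-> S%:E = mu (first_edge_in B')].
Proof.
move=> partial_sum S; rewrite first_edge_inE.
have fmu n : mu (sub_prefix B' n) \is a fin_num.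
  by rewrite fin_num_measure//; exact: measurable_sub_prefix.
have fX : mu (sub_path_space B') \is a fin_num.
  rewrite fin_num_measure//.
  rewrite sub_path_spaceE.
  by apply: bigcapT_measurable => n; exact: measurable_sub_prefix.
have psE N : partial_sum N =
    fine (mu (sub_prefix B' 1)) - fine (mu (sub_prefix B' N.+1)).
  rewrite -[RHS]opprB -(telescope_sumr (fun n => fine (mu (sub_prefix B' n))))//.
  by rewrite -sumrN; apply: eq_bigr => n _; rewrite removed_massE// opprB.
have ps_cvg : partial_sum @ \oo -->
    fine (mu (sub_prefix B' 1)) - fine (mu (sub_path_space B')).
  rewrite (funext psE); apply: cvgB; first exact: cvg_cst.
  have := @fine_cvg _ _ _ _ (fun n => mu (sub_prefix B' n))
            (fine (mu (sub_path_space B'))).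
  rewrite fineK// => /(_ _ _ (@cvg_sub_prefix _ _ mu B')).
  by rewrite -cvg_shiftS.
have SE : S = fine (mu (sub_prefix B' 1)) - fine (mu (sub_path_space B')).
  exact: cvg_lim.
have XE : mu (sub_path_space B') = (mu (sub_prefix B' 1) - S%:E)%E.
  by rewrite SE -(fineK (fmu 1)) -{1}(fineK fX) -EFinB subKr.
split=> //; first by apply/cvg_ex; eexists; exact: ps_cvg.
rewrite XE -(fineK (fmu 1)) -EFinB; split => [[] /eqP|[->]]; last by rewrite subrr.
by rewrite subr_eq0 => /eqP ->.
Qed.
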